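(* Let $\rho\in\mathcal{S}_+^{\rm mon}$, $1\le p<q<\infty$ and $\alpha\in\mathbb{N}$. There is a constant $C>0$ such that for every $n\in\mathbb{N}$ and every linear operator $A_n:W^{\alpha,q}_\rho(\mathbb{R})\to L^p_\rho(\mathbb{R})$ with $\mathrm{rank}(A_n)\le n$, $$\|I-A_n\|_{\mathscr{L}(W^{\alpha,q}_\rho(\mathbb{R}),L^p_\rho(\mathbb{R}))}\ge C\,\frac{1}{n^\alpha}.$$ In particular, $C$ is independent of $n$ and $A_n$.
   Context: $\mathbb{N}=\{1,2,\dots\}$, $\mathbb{N}_0=\mathbb{N}\cup\{0\}$. Monotonic Schwartz weights: $\mathcal{S}$ is the Schwartz space of $\omega\in C^\infty(\mathbb{R})$ with $\sup_{x\in\mathbb{R}}|x^a\omega^{(b)}(x)|<\infty$ for all $a,b\in\mathbb{N}_0$. $\mathcal{S}_+^{\rm mon}$ is the set of real-valued $\omega\in\mathcal{S}$ with $\omega(x)>0$ for all $x\in\mathbb{R}$ for which there exists $K>0$ such that $x\,\omega'(x)\le 0$ for all $x\in\mathbb{R}\setminus[-K,K]$. Function spaces: $L^p_\rho(\mathbb{R})$ has norm $\|f\|_{L^p_\rho(\mathbb{R})}=(\int_{\mathbb{R}}|f(x)|^p\rho(x)\,dx)^{1/p}$. For $1<q<\infty$, $\alpha\in\mathbb{N}$, $W^{\alpha,q}_\rho(\mathbb{R})$ is the space of functions $f:\mathbb{R}\to\mathbb{C}$ with weak derivatives $f^{(\tau)}$, $\tau=0,\dots,\alpha$, and $\|f\|_{W^{\alpha,q}_\rho(\mathbb{R})}=\big(\sum_{\tau=0}^\alpha\int_{\mathbb{R}}|f^{(\tau)}(x)|^q\rho(x)\,dx\big)^{1/q}<\infty$.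 $I$ is the embedding (identity), and $\|I-A_n\|_{\mathscr{L}(W^{\alpha,q}_\rho(\mathbb{R}),L^p_\rho(\mathbb{R}))}=\sup_{0\ne f\in W^{\alpha,q}_\rho(\mathbb{R})}\|f-A_nf\|_{L^p_\rho(\mathbb{R})}/\|f\|_{W^{\alpha,q}_\rho(\mathbb{R})}$ (possibly $+\infty$). *)

(* Defs.v *)
From HB Require Import structures.
From mathcomp Require Import all_boot all_order all_algebra.
From mathcomp Require Import all_classical all_reals all_analysis.
From mathcomp Require Export complex.

Set Implicit Arguments.
Unset Strict Implicit.
Unset Printing Implicit Defensive.

Import Order.TTheory GRing.Theory Num.Theory.
Import numFieldNormedType.Exports.

Local Open Scope classical_set_scope.
Local Open Scope ring_scope.

Definition smooth (R : realType) (w : R -> R) : Prop :=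
  forall (k : nat) (x : R), derivable (derive1n k w) x 1.

Definition schwartz (R : realType) (w : R -> R) : Prop :=
  smooth w /\
  forall a b : nat,
    (ereal_sup [set (`|x ^+ a * derive1n b w x|)%:E | x in [set: R]] < +oo)%E.

(* $\mathcal{S}_+^{\rm mon}$ *)
Definition schwartz_mon (R : realType) (w : R -> R) : Prop :=
  [/\ schwartz w,
      forall x : R, 0 < w x &
      exists K : R, 0 < K /\
        forall x : R, ~ `[- K, K]%classic x -> x * derive1 w x <= 0].

(* Elements of the function spaces below are represented by functions
   R -> R[i]; [aeq] is the equality of the classes they represent. Measurability
   is Borel measurability, which costs nothing since every Lebesgue measurable
   function is a.e. equal to a Borel one. *)
Definition aeq (R : realType) (f g : R -> R[i]) : Prop :=
  ae_eq lebesgue_measure [set: R] f g.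

Definition cmeasurable (R : realType) (f : R -> R[i]) : Prop :=
  measurable_fun [set: R] (fun x => complex.Re (f x)) /\
  measurable_fun [set: R] (fun x => complex.Im (f x)).

Definition clocally_integrable (R : realType) (f : R -> R[i]) : Prop :=
  locally_integrable [set: R] (fun x => complex.Re (f x)) /\
  locally_integrable [set: R] (fun x => complex.Im (f x)).

Definition cintegral (R : realType) (f : R -> R[i]) : R[i] :=
  Complex (\int[lebesgue_measure]_x complex.Re (f x))
          (\int[lebesgue_measure]_x complex.Im (f x)).

(* $\int_{\mathbb{R}} |f(x)|^p \rho(x)\,dx$, in [0, +oo] *)
Definition wint (R : realType) (rho : R -> R) (p : R) (f : R -> R[i]) : \bar R :=
  (\int[lebesgue_measure]_x (Normc.normc (f x) `^ p * rho x)%:E)%E.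

Definition Lp_norm (R : realType) (rho : R -> R) (p : R) (f : R -> R[i]) :
  \bar R := (wint rho p f `^ p^-1)%E.

Definition Lp_space (R : realType) (rho : R -> R) (p : R) : set (R -> R[i]) :=
  [set f | cmeasurable f /\ (Lp_norm rho p f < +oo)%E].

Definition test_function (R : realType) (phi : R -> R) : Prop :=
  smooth phi /\ compact (closure [set x | phi x != 0]).

Definition is_weak_deriv (R : realType) (k : nat) (f g : R -> R[i]) : Prop :=
  [/\ clocally_integrable f, clocally_integrable g &
      forall phi : R -> R, test_function phi ->
        cintegral (fun x => f x * real_complex R (derive1n k phi x)) =
        (-1) ^+ k * cintegral (fun x => g x * real_complex R (phi x))].

(* A weak derivative is unique up to a.e. equality, so the representative chosen
   here is irrelevant; the value is 0 when no weak derivative exists. *)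
Definition weak_deriv (R : realType) (k : nat) (f : R -> R[i]) : R -> R[i] :=
  xget (fun=> 0) [set g | is_weak_deriv k f g].

Definition sobolev_norm (R : realType) (rho : R -> R) (alpha : nat) (q : R)
    (f : R -> R[i]) : \bar R :=
  ((\sum_(0 <= tau < alpha.+1) wint rho q (weak_deriv tau f)) `^ q^-1)%E.

Definition sobolev_space (R : realType) (rho : R -> R) (alpha : nat) (q : R) :
    set (R -> R[i]) :=
  [set f | (forall tau, (tau <= alpha)%N -> exists g, is_weak_deriv tau f g) /\
           (sobolev_norm rho alpha q f < +oo)%E].

(* Linear operators between the spaces of classes represented by V and W. The
   operator is given on representatives, its values outside V are irrelevant. *)
Definition linear_operator (R : realType) (V W : set (R -> R[i]))
    (A : (R -> R[i]) -> (R -> R[i])) : Prop :=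
  [/\ forall f, V f -> W (A f),
      forall f g, V f -> V g -> aeq f g -> aeq (A f) (A g) &
      forall (c : R[i]) f g, V f -> V g ->
        aeq (A (fun x => c * f x + g x)) (fun x => c * A f x + A g x)].

(* The range of A is spanned by (at most) n of its elements. *)
Definition rank_le (R : realType) (V : set (R -> R[i]))
    (A : (R -> R[i]) -> (R -> R[i])) (n : nat) : Prop :=
  exists g : 'I_n -> R -> R[i],
    (forall i, V (g i)) /\
    forall f, V f -> exists c : 'I_n -> R[i],
      aeq (A f) (fun x => \sum_(i < n) c i * A (g i) x).

(* $\|I - A\|_{\mathscr{L}(W^{\alpha,q}_\rho, L^p_\rho)}$ *)
Definition opnorm_IsubA (R : realType) (rho : R -> R) (alpha : nat) (q p : R)
    (A : (R -> R[i]) -> (R -> R[i])) : \bar R :=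
  ereal_sup [set (Lp_norm rho p (fun x => (f x - A f x)%R) /
                  sobolev_norm rho alpha q f)%E
            | f in [set f | sobolev_space rho alpha q f /\ ~ aeq f (fun=> 0)]].

(* Main.v *)
Require Import Defs.
From mathcomp Require Import all_boot all_order all_algebra.
From mathcomp Require Import all_classical all_reals all_analysis.
From mathcomp Require Import measurable_realfun ring lra.

(** A finite-dimensional family of test objects forces the rate [n^-alpha].
    Split [0, 1] into [m = 3 n] cells of length [1 / m] and put on each of them
    a copy, shrunk to the cell, of the polynomial [(X (1 - X))^alpha].  For
    [c] in [R^m] let [f_c] be the combination of these bumps with coefficients
    [c].  The bumps glue to a function of class [C^(alpha - 1)] because all
    derivatives of order less than [alpha] vanish at the ends of the cells, so
    [f_c] has weak derivatives up to order [alpha], namely the piecewise ones,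
    and [f_c] lies in the weighted Sobolev space ([is_weak_deriv_spline],
    [spline_sobolev_space]).

    If [A] has rank at most [n], then [A f_c = 0] holds as soon as [c] satisfies
    [n] complex, that is [2 n] real, linear equations ([operator_kernel]).
    Their real solution space in [R^(3 n)] has dimension at least [n], and a
    subspace of dimension at least [n] contains a vector of sup norm at most 1
    with at least [n] coordinates of modulus exactly 1, an extreme point of its
    unit cube ([kernel_unimodular]).  This choice of [c] replaces the computation of
    the Gelfand numbers of the embedding of l_q into l_p for [p < q].

    For this [c], [f_c - A f_c = f_c].  On at least [n] of the [3 n] cells,
    [|f_c|] is at least a fixed height on half of the cell, so its weighted
    [L^p] norm is bounded below independently of [n] ([wint_spline_ge]); its
    derivatives of order up to [alpha] are bounded by a constant times
    [n^alpha], so its Sobolev norm is at most a constant times [n^alpha]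
    ([dspline_bound], [sobolev_norm_spline]).  The quotient of the two norms is
    the claimed bound.  The weight is controlled by its minimum, which is
    positive, and its maximum on [0, 1].

    Since the Sobolev norm is computed with some choice of weak derivatives, the
    upper bound rests on their uniqueness up to null sets
    ([weak_deriv_unique]): testing against smooth functions that converge to
    the indicator of an interval determines the integrals over all intervals,
    and Lebesgue's differentiation theorem recovers the function from them. *)

Set Implicit Arguments.
Unset Strict Implicit.
Unset Printing Implicit Defensive.

Import Order.TTheory GRing.Theory Num.Theory.
Import numFieldNormedType.Exports.

Local Open Scope classical_set_scope.
Local Open Scope ring_scope.

(** * Vectors with many unimodular coordinates in a kernel *)

Definition unimod (R : realFieldType) m (c : 'rV[R]_m) : {set 'I_m} :=
  [set j | `|c 0 j| == 1]%SET.

(** Dimension count: the equations [y *m M = 0] and [y 0 j = 0] for [j] in [T]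
    are fewer than the unknowns. *)
Lemma kernel_vector_vanishing (R : fieldType) m r (M : 'M[R]_(m, r))
    (T : {set 'I_m}) :
  (r + #|T| < m)%N ->
  exists2 y : 'rV[R]_m, y != 0 & y *m M = 0 /\ forall j, j \in T -> y 0 j = 0.
Proof.
move=> rTm.
pose A := row_mx M (\matrix_(i < m, k < #|T|) (i == enum_val k)%:R).
have kA : kermx A != 0.
  rewrite -mxrank_eq0 mxrank_ker subn_eq0 -ltnNge.
  exact: leq_ltn_trans (rank_leq_col A) rTm.
have : nz_row (kermx A) *m A = 0.
  by apply/sub_kermxP; exact: nz_row_sub.
rewrite mul_mx_row => /eqP; rewrite row_mx_eq0 => /andP[/eqP yM /eqP yT].
exists (nz_row (kermx A)); first by rewrite nz_row_eq0.
split => // j jT.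
move/matrixP/(_ 0 (enum_rank_in jT j)) : yT.
rewrite !mxE (bigD1 j)//= mxE enum_rankK_in// eqxx mulr1 big1 ?addr0//.
by move=> i ij; rewrite mxE enum_rankK_in// (negbTE ij) mulr0.
Qed.

(** The cube [|x_j| <= 1] is left by the half-line [x + t y] through a facet
    that does not contain [x]; at the exit point one more coordinate has
    modulus 1, while those of [x] are kept. *)
Lemma unimod_step (R : realFieldType) m (x y : 'rV[R]_m) :
  (forall j, `|x 0 j| <= 1) -> y != 0 ->
  (forall j, j \in unimod x -> y 0 j = 0) ->
  exists t, (forall j, `|(x + t *: y) 0 j| <= 1) /\
            (#|unimod x| < #|unimod (x + t *: y)|)%N.
Proof.
move=> x1 y0 yT.
have /rV0Pn[j0 yj0] := y0.
(* [s j] is the time at which coordinate [j] leaves [-1, 1]. *)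
pose s j := if 0 <= y 0 j then (1 - x 0 j) / y 0 j else (- 1 - x 0 j) / y 0 j.
have s0 j : y 0 j != 0 -> 0 <= s j.
  move=> yj; have := x1 j; rewrite ler_norml => /andP[h1 h2].
  rewrite /s; case: ifPn => [yp|]; first by rewrite divr_ge0// subr_ge0.
  by rewrite -ltNge => yn; rewrite ler_ndivlMr// mul0r subr_le0.
pose i := [arg min_(i < j0 | y 0 i != 0) s i]%O.
have [yi smin] : y 0 i != 0 /\ forall j, y 0 j != 0 -> s i <= s j.
  by rewrite /i; case: Order.TotalTheory.arg_minP.
have si : `|(x + s i *: y) 0 i| = 1.
  rewrite !mxE /s; case: ifPn => _; rewrite divfK// addrC subrK ?normr1//.
  by rewrite normrN1.
exists (s i); split => [j|].
  rewrite !mxE; have [->|yj] := eqVneq (y 0 j) 0; first by rewrite mulr0 addr0.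
  have := x1 j; have := smin _ yj; have := s0 _ yi.
  move: (s i) => t t0; rewrite /s !ler_norml; case: ifPn => [yp|].
    have {}yp : 0 < y 0 j by rewrite lt_neqAle eq_sym yj.
    rewrite ler_pdivlMr// => h /andP[h1 h2].
    have := mulr_ge0 t0 (ltW yp); lra.
  rewrite -ltNge => yn; rewrite ler_ndivlMr// => h /andP[h1 h2].
  have := mulr_ge0_le0 t0 (ltW yn); lra.
apply: proper_card; apply/properP; split.
  apply/fintype.subsetP => j jx; move: (jx); rewrite !inE !mxE.
  by rewrite (yT _ jx) mulr0 addr0.
exists i; first by rewrite inE si.
by apply: contra yi => /yT ->.
Qed.

(** Take a solution in the unit cube with the largest number of unimodular
    coordinates.  If there were fewer than [m - r] of them, a nonzero solution
    vanishing at these coordinates would give a direction in which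
    [unimod_step] improves it. *)
Lemma kernel_unimodular (R : realFieldType) m r (M : 'M[R]_(m, r)) :
  exists c : 'rV[R]_m, [/\ c *m M = 0, forall j, `|c 0 j| <= 1 &
    (m - r <= #|unimod c|)%N].
Proof.
pose P d := `[< exists c : 'rV[R]_m, [/\ c *m M = 0, forall j, `|c 0 j| <= 1 &
    #|unimod c| = d] >].
have P0 : exists d, P d.
  exists #|unimod (0 : 'rV[R]_m)|; apply/asboolP; exists 0; split => //.
    by rewrite mul0mx.
  by move=> j; rewrite mxE normr0.
have Pm d : P d -> (d <= m)%N.
  move=> /asboolP[c [_ _ <-]]; apply: leq_trans (max_card _) _.
  by rewrite card_ord.
case: (ex_maxnP P0 Pm) => d /asboolP[c [cM c1 cd]] dmax.
exists c; split => //; rewrite leqNgt; apply/negP => h.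
have [|y y0 [yM yT]] := @kernel_vector_vanishing _ _ _ M (unimod c).
  by move: h; rewrite ltn_subRL.
have [t [t1 tc]] := unimod_step c1 y0 yT.
have : P #|unimod (c + t *: y)|.
  apply/asboolP; exists (c + t *: y); split => //.
  by rewrite mulmxDl -scalemxAl cM yM scaler0 addr0.
by move=> /dmax; rewrite -cd leqNgt tc.
Qed.

(** * Smooth functions *)

(** To prove smoothness it suffices to exhibit a class of differentiable
    functions that contains the function and is stable under derivation; this
    replaces explicit formulas for higher derivatives. *)
Lemma smooth_coind (R : realType) (P : (R -> R) -> Prop) :
  (forall f, P f -> (forall x, derivable f x 1) /\ P (derive1 f)) ->
  forall f, P f -> smooth f.
Proof.
move=> Pd f Pf k; elim: k f Pf => [|k ih] f /Pd[df Pf'] x; first exact: df.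
by rewrite derive1Sn; exact: ih.
Qed.

Lemma smooth_derive1 (R : realType) (f : R -> R) :
  smooth f -> smooth (derive1 f).
Proof. by move=> sf k x; rewrite -derive1Sn; exact: sf. Qed.

Lemma smooth_derivable (R : realType) (f : R -> R) x :
  smooth f -> derivable f x 1.
Proof. by move/(_ 0 x). Qed.

Lemma smooth_derive1n (R : realType) (f : R -> R) k :
  smooth f -> smooth (derive1n k f).
Proof.
by move=> sf; elim: k => [|k ih]; [exact: sf|exact: smooth_derive1].
Qed.

Lemma smooth_continuous (R : realType) (f : R -> R) : smooth f -> continuous f.
Proof.
by move=> sf x; apply/differentiable_continuous/derivable1_diffP/(sf 0).
Qed.

(** The stable class is that of the finite sums of products of two smooth
    functions. *)
Lemma smoothM (R : realType) (f g : R -> R) :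
  smooth f -> smooth g -> smooth (fun x => f x * g x).
Proof.
move=> sf sg.
apply: (@smooth_coind R (fun h => exists (I : finType) (u v : I -> R -> R),
  (forall i, smooth (u i) /\ smooth (v i)) /\
  h = fun x => \sum_i u i x * v i x)); last first.
  exists 'I_1, (fun=> f), (fun=> g); split => //.
  by apply/funext => x; rewrite big_ord1.
move=> h [I [u [v [suv ->]]]].
have du i x : is_derive x (1 : R) (u i) (derive1 (u i) x).
  by apply: DeriveDef; [exact/smooth_derivable/(suv i).1|rewrite derive1E].
have dv i x : is_derive x (1 : R) (v i) (derive1 (v i) x).
  by apply: DeriveDef; [exact/smooth_derivable/(suv i).2|rewrite derive1E].
have sD x : is_derive x (1 : R) (fun x : R => \sum_i u i x * v i x : R)
    (\sum_i derive1 (u i) x * v i x + \sum_i u i x * derive1 (v i) x).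
  rewrite -big_split/=; elim: (index_enum I) => [|i s ih].
    under eq_fun do rewrite big_nil.
    by rewrite big_nil; exact: is_derive_cst.
  under eq_fun do rewrite big_cons.
  rewrite big_cons.
  have := is_deriveD (is_deriveM (du i x) (dv i x)) ih => /is_derive_eq; apply.
  by rewrite /GRing.scale /=; ring.
split => [x|]; first by case: (sD x).
exists (I + I)%type,
  (fun i => match i with inl i => derive1 (u i) | inr i => u i end),
  (fun i => match i with inl i => v i | inr i => derive1 (v i) end).
split.
  case=> i; have [su sv] := suv i.
    by split; [exact: smooth_derive1|exact: sv].
  by split; [exact: su|exact: smooth_derive1].
apply/funext => x; rewrite derive1E; have [_ ->] := sD x.
by rewrite big_sumType.
Qed.

Lemma smooth_comp_affine (R : realType) (f : R -> R) (a b : R) :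
  smooth f -> smooth (fun x => f (a * x + b)).
Proof.
move=> sf.
apply: (@smooth_coind R (fun h => exists2 cg : R * (R -> R), smooth cg.2 &
  h = fun x => cg.1 * cg.2 (a * x + b))); last first.
  by exists (1, f) => //; apply/funext => x; rewrite mul1r.
move=> h [[c g] /= sg ->].
have sD x : is_derive x (1 : R) (fun x : R => c * g (a * x + b) : R)
    (c * a * (derive1 g) (a * x + b)).
  have d2 : is_derive (a * x + b) (1 : R) g ((derive1 g) (a * x + b)).
    by apply: DeriveDef; [exact: smooth_derivable|rewrite derive1E].
  have d1 : is_derive x (1 : R) (fun x : R => a * x + b : R) a.
    apply: is_derive_eq; rewrite /GRing.scale /=; ring.
  have := is_deriveZ c
    (@is_derive1_comp _ g (fun x : R => a * x + b) x _ _ d2 d1).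
  by move=> /is_derive_eq; apply; rewrite /GRing.scale /=; ring.
split => [x|]; first by case: (sD x).
exists (c * a, (derive1 g)); first exact: smooth_derive1.
by apply/funext => x; rewrite derive1E; have [_ ->] := sD x.
Qed.

(** The prototype of a smooth function that vanishes on a half-line is
    [exp (- 1 / x)]; the polynomial factor in [1 / x] makes the family stable
    under derivation. *)
Definition flat (R : realType) (Q : {poly R}) (x : R) : R :=
  if 0 < x then Q.[x^-1] * expR (- x^-1) else 0.

(** With [y = 1 / x], each monomial is controlled by [y^i <= i! exp y]. *)
Lemma flat_bounded (R : realType) (Q : {poly R}) :
  exists M, forall x, `|flat Q x| <= M.
Proof.
exists (\sum_(i < size Q) `|Q`_i| * i`!%:R) => x.
have M0 : 0 <= \sum_(i < size Q) `|Q`_i| * i`!%:R.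
  by apply: sumr_ge0 => i _; apply: mulr_ge0.
rewrite /flat; case: ifPn => x0; last by rewrite normr0.
rewrite horner_coef mulr_suml (le_trans (ler_norm_sum _ _ _))//.
rewrite ler_sum// => i _.
rewrite -mulrA normrM ler_wpM2l//.
have y0 : 0 < x^-1 by rewrite invr_gt0.
rewrite ger0_norm ?mulr_ge0 ?exprn_ge0 ?expR_ge0 ?(ltW y0)//.
rewrite expRN ler_pdivrMr ?expR_gt0//.
case: i => -[|i] _ /=.
  by rewrite expr0 fact0 mul1r (le_trans _ (expR_ge1Dx _))// lerDl ltW.
have := expR_ge1Dxn i (ltW y0).
rewrite -ler_pdivrMl ?ltr0n ?fact_gt0// => h.
by rewrite (le_trans _ h)// mulrC lerDr.
Qed.

Lemma flat_mulX (R : realType) (Q : {poly R}) x :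
  flat Q x = x * flat ('X * Q) x.
Proof.
rewrite /flat; case: ifPn => x0; last by rewrite mulr0.
by rewrite hornerM hornerX !mulrA divff ?gt_eqF// mul1r.
Qed.

(** Away from 0 this is the chain rule.  At 0 the difference quotient equals
    [h * flat ('X * ('X * Q)) h], a bounded function times [h]. *)
Lemma is_derive_flat (R : realType) (Q : {poly R}) (x : R) :
  is_derive x (1 : R) (flat Q) (flat ('X^2 * (Q - Q^`())) x).
Proof.
have [x0|x0|->] := ltgtP x 0.
- rewrite [X in is_derive _ _ _ X]/flat ltNge (ltW x0)/=.
  apply: (@near_eq_is_derive _ _ _ (cst 0)).
  near=> y; have y0 : y < 0 by near: y; exact: lt_nbhsl.
  by rewrite /flat ltNge (ltW y0).
- rewrite [X in is_derive _ _ _ X]/flat x0.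
  apply: (@near_eq_is_derive _ _ _ (fun x : R => Q.[x^-1] * expR (- x^-1))).
    near=> y; rewrite /flat ifT//=.
    by near: y; exact: lt_nbhsr.
  have dV : is_derive x (1 : R) (fun x : R => x^-1) (- x ^- 2).
    have := @is_deriveV R id x 1 1 (lt0r_neq0 x0) (is_derive_id _ _).
    by move=> /is_derive_eq; apply; rewrite /GRing.scale /=; ring.
  have d1 : is_derive x (1 : R) (fun x : R => Q.[x^-1] : R)
      (Q^`().[x^-1] * - x ^- 2).
    exact: (@is_derive1_comp _ (horner Q) (fun x : R => x^-1) x _ _ _ dV).
  have dN : is_derive x (1 : R) (fun x : R => - x^-1) (x ^- 2).
    have := is_deriveN dV.
    by move=> /is_derive_eq; apply; rewrite opprK.
  have d2 : is_derive x (1 : R) (fun x : R => expR (- x^-1) : R)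
      (expR (- x^-1) * x ^- 2).
    exact: (@is_derive1_comp _ expR (fun x : R => - x^-1) x _ _ _ dN).
  have := is_deriveM d1 d2.
  move=> /is_derive_eq; apply; rewrite !hornerE /GRing.scale /= exprVn.
  ring.
- suff h : (fun h : R => h^-1 *: (flat Q (h *: 1 + 0) - flat Q 0)) @ 0^' -->
      (0 : R).
    rewrite [X in is_derive _ _ _ X]/flat ltxx; apply: DeriveDef.
      by apply/cvg_ex; exists 0; exact: h.
    exact: (cvg_lim _ h).
  have [M hM] := flat_bounded ('X * ('X * Q)).
  have e (h : R) : h^-1 *: (flat Q (h *: 1 + 0) - flat Q 0) =
      h * flat ('X * ('X * Q)) h.
    rewrite /GRing.scale /= addr0 mulr1 {2}/flat ltxx subr0.
    have [->|h0] := eqVneq h 0; first by rewrite invr0 !mul0r.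
    by rewrite flat_mulX (mulrA h^-1) mulVf// mul1r flat_mulX.
  under eq_fun do rewrite e.
  have Mh : M * `|h| @[h --> (0 : R)] --> (0 : R).
    rewrite -[X in _ --> X](mulr0 M); apply: cvgMr.
    by rewrite -[X in _ --> X](@normr0 _ R); apply: cvg_norm; exact: cvg_id.
  apply: cvg_within_filter.
  apply: (@squeeze_cvgr _ _ _ _
    (fun h : R => - (M * `|h|)) (fun h => M * `|h|)).
  + by apply: nearW => h; rewrite -ler_norml normrM mulrC ler_wpM2r.
  + by rewrite -[X in _ --> X]oppr0; exact: cvgN.
  + exact: Mh.
Unshelve. all: by end_near. Qed.

Lemma smooth_flat (R : realType) (Q : {poly R}) : smooth (flat Q).
Proof.
apply: (@smooth_coind R (fun h => exists Q, h = flat Q)); last by exists Q.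
move=> _ [{}Q ->]; split => [x|]; first by case: (is_derive_flat Q x).
exists ('X^2 * (Q - Q^`())).
by apply/funext => x; rewrite derive1E; have [_ ->] := is_derive_flat Q x.
Qed.

(** These test functions vanish outside [(a, b)], take values in [0, 1] and
    converge pointwise to the indicator of the open interval when [k] grows. *)
Definition plateau (R : realType) (a b : R) (k : nat) (x : R) : R :=
  flat 1 (k.+1%:R * (x - a)) * flat 1 (k.+1%:R * (b - x)).

Lemma flat1_ge0_le1 (R : realType) (x : R) : 0 <= flat 1 x <= 1.
Proof.
rewrite /flat; case: ifPn => x0; last by rewrite lexx ler01.
by rewrite hornerC mul1r expR_ge0 expR_le1 oppr_le0 invr_ge0 ltW.
Qed.

Lemma plateau_ge0_le1 (R : realType) (a b : R) k x : 0 <= plateau a b k x <= 1.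
Proof.
rewrite /plateau; have /andP[? ?] := flat1_ge0_le1 (k.+1%:R * (x - a)).
have /andP[? ?] := flat1_ge0_le1 (k.+1%:R * (b - x)).
by rewrite mulr_ge0//= mulr_ile1.
Qed.

Lemma plateau_eq0 (R : realType) (a b : R) k x :
  x \notin `]a, b[ -> plateau a b k x = 0.
Proof.
rewrite in_itv/= negb_and -!leNgt => /orP[h|h]; rewrite /plateau.
  rewrite {1}/flat ltNge (_ : _ <= 0) ?mul0r//.
  by rewrite pmulr_rle0 ?ltr0n// subr_le0.
rewrite {2}/flat ltNge (_ : _ <= 0) ?mulr0//.
by rewrite pmulr_rle0 ?ltr0n// subr_le0.
Qed.

Lemma test_function_plateau (R : realType) (a b : R) k :
  test_function (plateau a b k).
Proof.
split.
  apply: smoothM.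
    rewrite [X in smooth X](_ : _ =
      fun x => flat 1 (k.+1%:R * x + - (k.+1%:R * a))).
      by apply: smooth_comp_affine; exact: smooth_flat.
    by apply/funext => x; rewrite mulrBr.
  rewrite [X in smooth X](_ : _ =
    fun x => flat 1 (- k.+1%:R * x + (k.+1%:R * b))).
    by apply: smooth_comp_affine; exact: smooth_flat.
  by apply/funext => x; rewrite mulrBr mulNr addrC.
apply: (@subclosed_compact _ _ `[a, b]%classic).
- exact: closed_closure.
- exact: segment_compact.
- rewrite closureE; apply: smallest_sub; first exact: itv_closed.
  move=> x /= bx; apply: contrapT => xab; move/eqP: bx; apply.
  apply: plateau_eq0; apply/negP => xab'; apply: xab.
  by apply: subset_itv_oo_cc; exact: xab'.
Qed.

Lemma cvg_flat1 (R : realType) (x : R) :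
  flat 1 (k.+1%:R * x) @[k --> \oo] --> ((0 < x)%R%:R : R).
Proof.
have [x0|x0] := ltP 0 x; last first.
  rewrite [X in X @ _ --> _](_ : _ = fun=> 0); first exact: cvg_cst.
  by apply/funext => k; rewrite /flat ltNge pmulr_rle0 ?ltr0n// x0.
rewrite [X in X @ _ --> _](_ : _ = fun k => expR (- (k.+1%:R^-1 * x^-1)));
  last first.
  apply/funext => k.
  by rewrite /flat pmulr_rgt0 ?ltr0n// x0 hornerC mul1r invfM.
rewrite -[X in _ --> X](@expR0 R).
apply: continuous_cvg; first exact: continuous_expR.
rewrite -oppr0; apply: cvgN; rewrite -[X in _ --> X](mul0r x^-1); apply: cvgMl.
exact: cvg_harmonic.
Qed.

Lemma cvg_plateau (R : realType) (a b x : R) :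
  plateau a b k x @[k --> \oo] --> (\1_(`]a, b[%classic) x : R).
Proof.
rewrite indicE.
have -> : (x \in `]a, b[%classic)%:R = (0 < x - a)%R%:R * (0 < b - x)%R%:R :> R.
  rewrite mem_setE in_itv/= !subr_gt0.
  by case: (a < x); case: (x < b); rewrite ?mulr0 ?mulr1.
by apply: cvgM; exact: cvg_flat1.
Qed.

(** * Uniqueness of weak derivatives *)

Lemma locally_integrable_itv (R : realType) (g : R -> R) (a b : R) :
  locally_integrable [set: R] g ->
  lebesgue_measure.-integrable `]a, b[ (EFin \o g).
Proof.
move=> [mg _ ig].
suff : lebesgue_measure.-integrable `[a, b] (EFin \o g).
  by apply: integrableS => //; exact: subset_itv_oo_cc.
apply/integrableP; split.
  by apply/measurable_EFinP; exact: measurable_funTS.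
by apply: ig => //; exact: segment_compact.
Qed.

(** Dominated convergence, with [|g|] on the interval as the bound. *)
Lemma cvg_integral_plateau (R : realType) (g : R -> R) (a b : R) :
  locally_integrable [set: R] g ->
  (\int[lebesgue_measure]_x (g x * plateau a b k x)) @[k --> \oo] -->
  \int[lebesgue_measure]_(x in `]a, b[) g x.
Proof.
move=> lg; have ig := locally_integrable_itv a b lg; have [mg _ _] := lg.
have mb k : measurable_fun [set: R] (plateau a b k).
  apply: continuous_measurable_fun.
  exact: smooth_continuous (test_function_plateau a b k).1.
have bg k x : (`|(g x * plateau a b k x)%:E| <= `|(g x)%:E|)%E.
  rewrite lee_fin normrM; have /andP[b0 b1] := plateau_ge0_le1 a b k x.
  by rewrite ler_piMr// ger0_norm.
have ib k : lebesgue_measure.-integrable `]a, b[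
    (fun x => (g x * plateau a b k x)%:E).
  apply: le_integrable ig => //.
  apply/measurable_EFinP; apply: measurable_funM.
    exact: measurable_funTS mg.
  exact: measurable_funTS (mb k).
have -> : (fun k => \int[lebesgue_measure]_x (g x * plateau a b k x)) =
    (fun k => \int[lebesgue_measure]_(x in `]a, b[) (g x * plateau a b k x)).
  apply/funext => k; rewrite [RHS]Rintegral_mkcond; congr Rintegral.
  apply/funext => x; rewrite patchE; case: ifPn => //.
  rewrite mem_setE => xab; rewrite plateau_eq0 ?mulr0//.
apply: fine_cvg; rewrite fineK ?integrable_fin_num//.
have := @dominated_convergence _ _ _ lebesgue_measure `]a, b[%classic
  (measurable_itv _) (fun k x => (g x * plateau a b k x)%:E)
  (fun x => (g x)%:E) (fun x => `|(g x)%:E|)%E.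
case => //.
- by move=> k; case/integrableP : (ib k).
- by case/integrableP : ig.
- apply/aeW => x xab; apply: cvg_EFin; first exact: nearW.
  rewrite /comp/= -[X in _ --> X]mulr1.
  apply: cvgMr; have := @cvg_plateau R a b x.
  by rewrite indicE mem_set.
- exact: integrable_abse.
- by apply/aeW => x k _; exact: bg.
Qed.

(** Fundamental lemma of the calculus of variations.  By the previous lemma the
    two functions have the same integral over every open interval, hence the
    same averages over the balls around a point; at a common Lebesgue point the
    averages converge to the values of both functions. *)
Lemma ae_eq_test_function (R : realType) (g1 g2 : R -> R) :
  locally_integrable [set: R] g1 -> locally_integrable [set: R] g2 ->
  (forall phi, test_function phi ->
     \int[lebesgue_measure]_x (g1 x * phi x) =
     \int[lebesgue_measure]_x (g2 x * phi x)) ->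
  ae_eq lebesgue_measure [set: R] g1 g2.
Proof.
move=> l1 l2 g12.
have e12 a b : (\int[lebesgue_measure]_(x in `]a, b[) (g1 x)%:E =
                \int[lebesgue_measure]_(x in `]a, b[) (g2 x)%:E)%E.
  rewrite -[LHS]fineK ?integrable_fin_num//; last exact: locally_integrable_itv.
  rewrite -[RHS]fineK ?integrable_fin_num//; last exact: locally_integrable_itv.
  congr (_%:E).
  have := @cvg_integral_plateau R _ a b l1.
  have := @cvg_integral_plateau R _ a b l2.
  have -> : (fun k => \int[lebesgue_measure]_x (g2 x * plateau a b k x)) =
            (fun k => \int[lebesgue_measure]_x (g1 x * plateau a b k x)).
    by apply/funext => k; rewrite g12//; exact: test_function_plateau.
  by move=> h2 h1; exact: (cvg_unique _ h1 h2).
pose E (x : R) (n : nat) : set R := ball x n.+1%:R^-1.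
have hE x : nicely_shrinking x (E x).
  split; first by move=> n; exact: measurable_ball.
  have p (n : nat) : 0 < (n.+1%:R^-1 : R) by rewrite invr_gt0 ltr0n.
  exists (1, fun n => PosNum (p n)); split => /=.
  - exact: ltr01.
  - exact: cvg_harmonic.
  - by move=> n; exact: subset_refl.
  - by move=> n; rewrite mul1e.
apply: (@filterS2 _ _ (ae_filter_ringOfSetsType lebesgue_measure) _ _ _ _
  (lebesgue_differentiation l1) (lebesgue_differentiation l2)).
move=> x x1 x2 _.
have h1 := nice_lebesgue_differentiation hE l1 x1.
have h2 := nice_lebesgue_differentiation hE l2 x2.
suff [] : (g1 x)%:E = (g2 x)%:E by [].
apply: (@cvg_unique _ (@ereal_hausdorff R) _ _ _ _ h1).
rewrite (_ : (fun n => _) = (fun n => (lebesgue_measure (E x n))^-1 *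
  \int[lebesgue_measure]_(y in E x n) (g2 y)%:E)%E) //.
by apply/funext => n; congr (_ * _)%E; rewrite /E ball_itv.
Qed.

Lemma weak_deriv_unique (R : realType) k (f g1 g2 : R -> R[i]) :
  is_weak_deriv k f g1 -> is_weak_deriv k f g2 -> aeq g1 g2.
Proof.
move=> [_ [lr1 li1] w1] [_ [lr2 li2] w2].
have e phi : test_function phi ->
    cintegral (fun x => g1 x * real_complex R (phi x)) =
    cintegral (fun x => g2 x * real_complex R (phi x)).
  move=> tphi.
  have s0 : (-1) ^+ k != 0 :> R[i] by rewrite signr_eq0.
  by apply: (mulfI s0); rewrite -w1// -w2.
have RE (g : R -> R[i]) phi :
    cintegral (fun x => g x * real_complex R (phi x)) =
    Complex (\int[lebesgue_measure]_x (complex.Re (g x) * phi x))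
            (\int[lebesgue_measure]_x (complex.Im (g x) * phi x)).
  rewrite /cintegral; congr Complex; apply: eq_Rintegral => x _.
    by case: (g x) => u v /=; rewrite mulr0 subr0.
  by case: (g x) => u v /=; rewrite mulr0 add0r.
have h1 : ae_eq lebesgue_measure [set: R]
    (fun x => complex.Re (g1 x)) (fun x => complex.Re (g2 x)).
  by apply: ae_eq_test_function => // phi /e; rewrite !RE => -[].
have h2 : ae_eq lebesgue_measure [set: R]
    (fun x => complex.Im (g1 x)) (fun x => complex.Im (g2 x)).
  by apply: ae_eq_test_function => // phi /e; rewrite !RE => -[].
apply: (@filterS2 _ _ (ae_filter_ringOfSetsType lebesgue_measure) _ _ _ _
  h1 h2) => x + + _ => /(_ Logic.I) + /(_ Logic.I).
by case: (g1 x) (g2 x) => [? ?] [? ?] /= -> ->.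
Qed.

(** * Piecewise polynomial functions *)

(** Iterated integration by parts: the boundary terms contain only derivatives
    of [G] of order less than [k]. *)
Lemma integral_horner_derive1n (R : realType) (a b : R) (phi : R -> R) k :
  a < b -> smooth phi -> forall G : {poly R},
  (forall i, (i < k)%N -> G^`(i).[a] = 0 /\ G^`(i).[b] = 0) ->
  \int[lebesgue_measure]_(x in `[a, b]) (G.[x] * derive1n k phi x) =
  (-1) ^+ k * \int[lebesgue_measure]_(x in `[a, b]) (G^`(k).[x] * phi x).
Proof.
move=> ab sphi; elim: k => [|k ih] G G0; first by rewrite expr0 mul1r.
have LR (h : R -> R) : continuous h -> (forall x, derivable h x 1) ->
    derivable_oo_LRcontinuous h a b.
  move=> ch dh; split => //.
    by apply: cvg_at_right_filter; exact: ch.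
  by apply: cvg_at_left_filter; exact: ch.
have sk j : continuous (derive1n j phi).
  by apply: smooth_continuous; exact: smooth_derive1n.
rewrite (@Rintegration_by_parts R (horner G) (derive1n k phi)
  (horner G^`()) (derive1n k.+1 phi))//; first last.
- by apply: LR => //; exact: sphi.
- by apply: continuous_subspaceT; exact: sk.
- by move=> x _; rewrite derivE.
- by apply: LR; [exact: continuous_horner|exact: derivable_horner].
- by apply: continuous_subspaceT; exact: continuous_horner.
have [] := G0 0 (ltn0Sn _); rewrite derivn0 => -> ->.
rewrite !mul0r subrr sub0r ih; first by rewrite derivSn exprS mulN1r mulNr.
by move=> i ik; have := G0 i.+1 ik; rewrite derivSn.
Qed.

Lemma ord_natr_gt0 (R : numDomainType) m (j : 'I_m) : 0 < m%:R :> R.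
Proof. by rewrite ltr0n; exact: leq_ltn_trans (ltn_ord j). Qed.

(** Half-open cells, so that a point belongs to one cell at most and the value
    of a piecewise function there is given by a single polynomial. *)
Definition cell (R : realType) m (j : nat) : set R :=
  `[j%:R / m%:R, j.+1%:R / m%:R[%classic.
Arguments cell : clear implicits.

Definition piecewise (R : realType) m (G : 'I_m -> {poly R}) (x : R) : R :=
  \sum_(j < m) (horner (G j) \_ (cell R m j)) x.

Section cells.
Variables (R : realType) (m : nat).
Implicit Types (j : 'I_m) (G : 'I_m -> {poly R}) (x : R).

Lemma cell_lt j : (j%:R / m%:R : R) < j.+1%:R / m%:R.
Proof.
by rewrite ltr_pM2r ?ltr_nat// invr_gt0 (ord_natr_gt0 _ j).
Qed.

Lemma measurable_cell (j : nat) : measurable (cell R m j).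
Proof. exact: measurable_itv. Qed.

Lemma cell01 j : cell R m j `<=` `[0, 1].
Proof.
move=> x; rewrite /cell /= !in_itv/= => /andP[jx xj].
have m0 : 0 < m%:R :> R := ord_natr_gt0 R j.
rewrite (le_trans _ jx) ?divr_ge0//= (le_trans (ltW xj))//.
by rewrite ler_pdivrMr// mul1r ler_nat.
Qed.

Lemma cell_inj (i j : 'I_m) x : cell R m i x -> cell R m j x -> i = j.
Proof.
have m0 : 0 < m%:R :> R := ord_natr_gt0 R i.
rewrite /cell /= !in_itv/= !ler_pdivrMr// !ltr_pdivlMr//.
move=> /andP[i1 i2] /andP[j1 j2]; apply/val_inj/eqP => /=.
rewrite eqn_leq -ltnS -(ltnS j) -!(ltr_nat R).
by rewrite (le_lt_trans i1 j2) (le_lt_trans j1 i2).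
Qed.

Lemma piecewise_cell G j x : cell R m j x -> piecewise G x = (G j).[x].
Proof.
move=> jx; rewrite /piecewise (bigD1 j)//= big1 ?addr0.
  by rewrite patchE mem_set.
move=> i ij; rewrite patchE memNset// => /cell_inj/(_ jx) e.
by rewrite e eqxx in ij.
Qed.

Lemma piecewise_notin G x : (forall j, ~ cell R m j x) -> piecewise G x = 0.
Proof.
move=> h; rewrite /piecewise big1// => j _; rewrite patchE memNset//.
Qed.

Lemma piecewise_bounded G B : 0 <= B ->
  (forall j x, cell R m j x -> `|(G j).[x]| <= B) ->
  forall x, `|piecewise G x| <= B.
Proof.
move=> B0 GB x; have [[j jx]|/forallNP h] := pselect (exists j, cell R m j x).
  by rewrite (piecewise_cell _ jx) GB.
by rewrite piecewise_notin// normr0.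
Qed.

Lemma piecewise_eq0 G x : ~ `[0, 1]%classic x -> piecewise G x = 0.
Proof. by move=> x01; apply: piecewise_notin => j /cell01. Qed.

Lemma measurable_piecewise G : measurable_fun [set: R] (piecewise G).
Proof.
apply: measurable_sum => j; apply/(measurable_restrictT _ _).1.
  exact: measurable_cell.
apply: measurable_funTS; apply: continuous_measurable_fun.
exact: continuous_horner.
Qed.

Lemma integrable_horner_cell (p : {poly R}) (psi : R -> R) (j : nat) :
  continuous psi ->
  lebesgue_measure.-integrable (cell R m j) (fun x => (p.[x] * psi x)%:E).
Proof.
move=> cpsi.
suff : lebesgue_measure.-integrable `[j%:R / m%:R, j.+1%:R / m%:R]
    (fun x => (p.[x] * psi x)%:E).
  by rewrite /cell; apply: integrableS => //; exact: subset_itv_co_cc.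
apply: continuous_compact_integrable; first exact: segment_compact.
apply: continuous_subspaceT => x; apply: cvgM; last exact: cpsi.
exact: continuous_horner.
Qed.

Lemma locally_integrable_piecewise G :
  locally_integrable [set: R] (piecewise G).
Proof.
rewrite /piecewise; elim: (index_enum _) => [|j s ih].
  under eq_fun do rewrite big_nil.
  apply: open_integrable_locally; first exact: openT.
  exact: integrable0.
under eq_fun do rewrite big_cons.
apply: (locally_integrableD _ ih).
apply: integrable_locally_restrict; first exact: measurable_cell.
have := @integrable_horner_cell (G j) (cst 1) j (@cst_continuous _ _ _).
by under eq_fun do rewrite mulr1.
Qed.

Lemma integral_piecewiseM G (psi : R -> R) : continuous psi ->
  \int[lebesgue_measure]_x (piecewise G x * psi x) =
  \sum_(j < m) \int[lebesgue_measure]_(x in `[j%:R / m%:R, j.+1%:R / m%:R])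
     ((G j).[x] * psi x).
Proof.
move=> cpsi.
have ic j : lebesgue_measure.-integrable [set: R]
    (EFin \o ((fun x => (G j).[x] * psi x) \_ (cell R m j))).
  rewrite -restrict_EFin.
  apply/integrable_restrict => //; first exact: measurable_cell.
  rewrite setTI.
  exact: integrable_horner_cell.
transitivity (\int[lebesgue_measure]_x
    (\sum_(j < m) ((fun x => (G j).[x] * psi x) \_ (cell R m j)) x)).
  apply: eq_Rintegral => x _; rewrite /piecewise mulr_suml.
  apply: eq_bigr => j _.
  by rewrite !patchE; case: ifPn => // _; rewrite mul0r.
transitivity (\sum_(j < m) \int[lebesgue_measure]_x
    ((fun x => (G j).[x] * psi x) \_ (cell R m j)) x).
  elim: (index_enum _) => [|j s ih].
    under eq_Rintegral do rewrite big_nil.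
    by rewrite big_nil /Rintegral integral0.
  under eq_Rintegral do rewrite big_cons.
  rewrite big_cons RintegralD//; first by congr (_ + _).
  have := @integrable_sum _ _ R lebesgue_measure setT measurableT _ s xpredT _
    (fun i _ => ic i).
  by apply: eq_integrable => //= x _; rewrite -sumEFin.
apply: eq_bigr => j _; rewrite -Rintegral_mkcond.
apply: Rintegral_itv_bndo_bndc.
exact: integrable_horner_cell.
Qed.

(** Integration by parts on each cell; the vanishing of the derivatives of order
    less than [k] at the nodes means that the pieces glue without jumps. *)
Lemma is_weak_deriv_piecewise G k :
  (forall j i, (i < k)%N -> (G j)^`(i).[j%:R / m%:R] = 0 /\
                            (G j)^`(i).[j.+1%:R / m%:R] = 0) ->
  is_weak_deriv k (fun x => real_complex R (piecewise G x))
    (fun x => real_complex R (piecewise (fun j => (G j)^`(k)) x)).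
Proof.
move=> G0.
have l0 : locally_integrable [set: R] (fun=> 0 : R).
  apply: open_integrable_locally; first exact: openT.
  exact: integrable0.
split.
- by split; [exact: locally_integrable_piecewise|exact: l0].
- by split; [exact: locally_integrable_piecewise|exact: l0].
move=> phi [sphi _].
have RE H (psi : R -> R) :
    cintegral
      (fun x => real_complex R (piecewise H x) * real_complex R (psi x)) =
    real_complex R (\int[lebesgue_measure]_x (piecewise H x * psi x)).
  rewrite /cintegral; congr Complex.
    by apply: eq_Rintegral => x _ /=; rewrite mulr0 subr0.
  transitivity (\int[lebesgue_measure]_(x in [set: R]) 0 : R).
    by apply: eq_Rintegral => x _ /=; rewrite mulr0 mul0r addr0.
  by rewrite /Rintegral integral0.
rewrite !RE -(rmorphN1 (real_complex R)) -rmorphXn -rmorphM; congr (_ _).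
rewrite !integral_piecewiseM; first last.
- by apply: smooth_continuous; exact: smooth_derive1n.
- exact: smooth_continuous.
rewrite mulr_sumr; apply: eq_bigr => j _.
apply: integral_horner_derive1n => //; first exact: cell_lt.
by move=> i ik; exact: G0.
Qed.

End cells.

(** * Splines made of rescaled bumps *)

Section pieces.
Variable R : realType.

(** Each derivation lowers the multiplicity of a root by at most one. *)
Lemma derivn_exp_factor (Q : {poly R}) k i :
  exists S, (Q ^+ (k + i))^`(i) = Q ^+ k * S.
Proof.
suff h : forall S, exists S', (Q ^+ (k + i) * S)^`(i) = Q ^+ k * S'.
  by have [S'] := h 1; rewrite mulr1 => e; exists S'.
elim: i => [|i ih] S; first by exists S; rewrite addn0 derivn0.
rewrite addnS derivSn derivM.
have [S' e] := ih (Q^`() *+ (k + i).+1 * S + Q * S^`()).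
exists S'; rewrite -e; congr (_^`(_)).
by rewrite deriv_exp /= exprS; ring.
Qed.

Definition profile (alpha : nat) : {poly R} := ('X * (1 - 'X)) ^+ alpha.

Lemma profile_derivn_eq0 alpha i : (i < alpha)%N ->
  (profile alpha)^`(i).[0] = 0 /\ (profile alpha)^`(i).[1] = 0.
Proof.
move=> ia; rewrite /profile; set Q := 'X * (1 - 'X).
have Q0 : Q.[0] = 0 by rewrite /Q !hornerE ?mul0r.
have Q1 : Q.[1] = 0 by rewrite /Q !hornerE ?subrr ?mulr0.
have [S] := @derivn_exp_factor Q (alpha - i) i.
rewrite subnK; last exact: ltnW.
move=> ->; rewrite !hornerM !horner_exp Q0 Q1.
by rewrite expr0n subn_eq0 leqNgt ia !mul0r.
Qed.

Lemma horner_bound (p : {poly R}) (x : R) : 0 <= x <= 1 ->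
  `|p.[x]| <= \sum_(i < size p) `|p`_i|.
Proof.
move=> /andP[x0 x1]; rewrite horner_coef (le_trans (ler_norm_sum _ _ _))//.
apply: ler_sum => i _; rewrite normrM ler_piMr// ger0_norm ?exprn_ge0//.
exact: exprn_ile1.
Qed.

(** For [p] on [0, 1], the copy of [p] that lives on the cell of index [j]. *)
Definition rescale m (j : nat) (p : {poly R}) : {poly R} :=
  p \Po (m%:R *: 'X - j%:R%:P).

Lemma derivn_rescale m j p k :
  (rescale m j p)^`(k) = m%:R ^+ k *: rescale m j p^`(k).
Proof.
elim: k p => [|k ih] p; first by rewrite expr0 scale1r.
rewrite derivSn /rescale deriv_comp derivB derivC derivZ derivX subr0.
rewrite -mulrC -scalerAl mul1r derivnZ -/(rescale _ _ _) ih.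
by rewrite scalerA -exprS -derivSn.
Qed.

Lemma horner_rescale m j (p : {poly R}) x :
  (rescale m j p).[x] = p.[m%:R * x - j%:R].
Proof. by rewrite /rescale horner_comp !hornerE. Qed.

Definition spline alpha m (c : 'rV[R]_m) (x : R) : R :=
  piecewise (fun j : 'I_m => c 0 j *: rescale m j (profile alpha)) x.

Definition dspline alpha m k (c : 'rV[R]_m) (x : R) : R :=
  piecewise (fun j : 'I_m => (c 0 j *: rescale m j (profile alpha))^`(k)) x.

Lemma spline_linear alpha m a (c c' : 'rV[R]_m) x :
  spline alpha (a *: c + c') x = a * spline alpha c x + spline alpha c' x.
Proof.
rewrite /spline /piecewise mulr_sumr -big_split/=; apply: eq_bigr => j _.
rewrite !patchE; case: ifPn => _; last by rewrite mulr0 addr0.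
by rewrite !mxE !hornerZ; ring.
Qed.

Lemma is_weak_deriv_spline alpha m k (c : 'rV[R]_m) : (k <= alpha)%N ->
  is_weak_deriv k (fun x => real_complex R (spline alpha c x))
                  (fun x => real_complex R (dspline alpha k c x)).
Proof.
move=> ka; apply: is_weak_deriv_piecewise => j i ik.
have m0 : m%:R != 0 :> R := lt0r_neq0 (ord_natr_gt0 R j).
rewrite derivnZ derivn_rescale !hornerZ !horner_rescale.
have [h0 h1] := profile_derivn_eq0 (leq_trans ik ka).
rewrite ![m%:R * _]mulrC !divfK// subrr h0.
by rewrite -natr1 addrC addKr h1 !mulr0.
Qed.

Lemma rescale_cell m (j : 'I_m) x : cell R m j x ->
  0 <= m%:R * x - j%:R <= 1.
Proof.
have m0 : 0 < m%:R :> R := ord_natr_gt0 R j.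
rewrite /cell /= in_itv/= ler_pdivrMr// ltr_pdivlMr// mulrC => /andP[h1 h2].
by rewrite subr_ge0 h1 /= lerBlDr addrC natr1 ltW.
Qed.

(** Only one cell contributes at a given point, so the bound does not see the
    number of bumps; the factor [m^k <= m^alpha] is the chain rule for the
    rescaling. *)
Lemma dspline_bound alpha : exists2 M : R, 0 < M &
  forall m k (c : 'rV[R]_m) D x, (k <= alpha)%N -> (0 < m)%N -> 0 <= D ->
  (forall j, `|c 0 j| <= D) ->
  `|dspline alpha k c x| <= D * (M * m%:R ^+ alpha).
Proof.
pose b k : R := \sum_(i < size (profile alpha)^`(k)) `|(profile alpha)^`(k)`_i|.
have b0 k : 0 <= b k by exact: sumr_ge0.
(* The summand 1 makes the constant positive. *)
exists (1 + \sum_(k < alpha.+1) b k).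
  by rewrite ltr_pwDl ?ltr01// sumr_ge0.
move=> m k c D x ka m0 D0 cD.
have bM : b k <= 1 + \sum_(k < alpha.+1) b k.
  rewrite (bigD1 (Ordinal (ka : (k < alpha.+1)%N)))//= addrCA lerDl.
  by rewrite addr_ge0// sumr_ge0.
have M0 : 0 <= 1 + \sum_(k < alpha.+1) b k := le_trans (b0 k) bM.
apply: piecewise_bounded => [|j {}x jx].
  by rewrite mulr_ge0// mulr_ge0// exprn_ge0.
rewrite derivnZ derivn_rescale !hornerZ horner_rescale !normrM.
rewrite ler_pM ?mulr_ge0// [leRHS]mulrC ler_pM//.
  by rewrite ger0_norm ?exprn_ge0// ler_weXn2l// ler1n.
by rewrite (le_trans (horner_bound _ (rescale_cell jx))).
Qed.

Lemma measurable_dspline alpha m k (c : 'rV[R]_m) :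
  measurable_fun [set: R] (dspline alpha k c).
Proof. exact: measurable_piecewise. Qed.

Lemma dspline_eq0 alpha m k (c : 'rV[R]_m) x :
  ~ `[0, 1]%classic x -> dspline alpha k c x = 0.
Proof. exact: piecewise_eq0. Qed.

(** The part of the cell where the rescaled profile is bounded below. *)
Definition middle_half m (j : nat) : set R :=
  `[(j%:R + 4^-1) / m%:R, (j%:R + 3 / 4) / m%:R]%classic.

Lemma middle_half_cell m (j : 'I_m) : middle_half m j `<=` cell R m j.
Proof.
have m0 : 0 < m%:R :> R := ord_natr_gt0 R j.
move=> x; rewrite /middle_half /cell /= !in_itv/=.
rewrite !ler_pdivrMr// !ler_pdivlMr// ltr_pdivlMr//.
by rewrite -[j.+1%:R]natr1 => /andP[h1 h2]; apply/andP; split; lra.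
Qed.

Lemma middle_half_measure m (j : nat) : (0 < m)%N ->
  lebesgue_measure (middle_half m j) = ((2 * m%:R)^-1)%:E.
Proof.
move=> m0; have m0' : 0 < m%:R :> R by rewrite ltr0n.
rewrite /middle_half lebesgue_measure_itv/= lte_fin ltr_pM2r ?invr_gt0//.
rewrite ifT; last by lra.
rewrite -EFinB -mulrBl; congr (_%:E).
by rewrite invfM; congr (_ * _); lra.
Qed.

(** For [1/4 <= y <= 3/4] one has [y (1 - y) >= 3/16 >= 1/16]. *)
Lemma spline_middle_half alpha m (c : 'rV[R]_m) j x :
  `|c 0 j| = 1 -> middle_half m j x ->
  (16^-1) ^+ alpha <= `|spline alpha c x|.
Proof.
move=> cj jx.
have m0 : 0 < m%:R :> R := ord_natr_gt0 R j.
rewrite /spline (piecewise_cell _ (middle_half_cell jx)).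
rewrite hornerZ normrM cj mul1r.
rewrite horner_rescale /profile horner_exp normrX !hornerE.
move: jx; rewrite /middle_half /= in_itv/= ler_pdivrMr// ler_pdivlMr// mulrC.
rewrite [m%:R * x]mulrC; set y := x * m%:R => /andP[y1 y2].
rewrite lerXn2r ?nnegrE// (le_trans _ (ler_norm _))//.
nra.
Qed.

End pieces.

(** * Weighted integrals *)

Lemma normc_real (R : realType) (x : R) :
  Normc.normc (real_complex R x) = `|x|.
Proof. by rewrite /= expr0n addr0 sqrtr_sqr. Qed.

Section weighted_integrals.
Variables (R : realType) (rho : R -> R).
Hypothesis mrho : measurable_fun [set: R] rho.
Hypothesis rho_gt0 : forall x, 0 < rho x.

Lemma measurable_wint (p : R) (f : R -> R[i]) : cmeasurable f ->
  measurable_fun [set: R] (fun x => Normc.normc (f x) `^ p * rho x).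
Proof.
move=> [mRe mIm]; apply: measurable_funM => //.
apply: (measurableT_comp (measurable_powR p)).
rewrite [X in measurable_fun _ X](_ : _ = fun x =>
    Num.sqrt (complex.Re (f x) ^+ 2 + complex.Im (f x) ^+ 2)); last first.
  by apply/funext => x; case: (f x).
apply: (measurableT_comp (continuous_measurable_fun (@sqrt_continuous R))).
by apply: measurable_funD; exact: measurable_funX.
Qed.

Lemma wint_aeq (p : R) (f g : R -> R[i]) :
  cmeasurable f -> cmeasurable g -> aeq f g -> wint rho p f = wint rho p g.
Proof.
move=> mf mg fg; apply: ae_eq_integral => //.
- by apply/measurable_EFinP; exact: measurable_wint.
- by apply/measurable_EFinP; exact: measurable_wint.
- apply: (@filterS _ _ (ae_filter_ringOfSetsType lebesgue_measure) _ _ _ fg).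
  by move=> x /[swap] _ /(_ Logic.I) ->.
Qed.

Lemma cmeasurable_real (F : R -> R) : measurable_fun [set: R] F ->
  cmeasurable (fun x => real_complex R (F x)).
Proof. by move=> mF; split => //; exact: measurable_cst. Qed.

Lemma wint_le (q B r : R) (F : R -> R) : 0 < q -> 0 <= B ->
  measurable_fun [set: R] F ->
  (forall x, `|F x| <= B) -> (forall x, ~ `[0, 1]%classic x -> F x = 0) ->
  (forall x, `[0, 1]%classic x -> rho x <= r) ->
  (wint rho q (fun x => real_complex R (F x)) <= (B `^ q * r)%:E)%E.
Proof.
move=> q0 B0 mF FB F0 rr; rewrite /wint.
under eq_integral do rewrite normc_real.
have -> : (fun x => (`|F x| `^ q * rho x)%:E) =
    (fun x => (`|F x| `^ q * rho x)%:E) \_ `[0, 1].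
  apply/funext => x; rewrite patchE; case: ifPn => // /negP x01.
  by rewrite F0 ?normr0 ?powR0 ?gt_eqF ?mul0r// => ?; apply: x01; rewrite inE.
rewrite -integral_mkcond.
have r0 : 0 <= r.
  by apply: le_trans (ltW (rho_gt0 0)) (rr _ _); rewrite /= in_itv/= lexx ler01.
apply: (@le_trans _ _
  (\int[lebesgue_measure]_(x in `[0%R, 1%R]) (cst (B `^ q * r)%:E) x)%E).
  apply: ge0_le_integral => //.
  - by move=> x _; rewrite lee_fin mulr_ge0 ?powR_ge0// ltW.
  - apply/measurable_EFinP/measurable_funTS.
    have := measurable_wint q (cmeasurable_real mF).
    by under eq_fun do rewrite normc_real.
  - move=> x x01; rewrite lee_fin ler_pM ?powR_ge0 ?(ltW (rho_gt0 _)) ?rr//.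
    by rewrite ge0_ler_powR ?nnegrE// ltW.
rewrite integral_cst//= lebesgue_measure_itv/= lte_fin ltr01.
by rewrite oppr0 adde0 mule1.
Qed.

(** The integral is bounded below by that of the sum of the constants
    [d^p * r] on the pairwise disjoint sets [J j] with [j] in [T], all of
    measure [l]. *)
Lemma wint_ge (p d r l : R) (F : R -> R) m (J : 'I_m -> set R)
    (T : {set 'I_m}) :
  0 <= p -> 0 <= d -> 0 <= r -> measurable_fun [set: R] F ->
  (forall j, measurable (J j)) ->
  (forall j, lebesgue_measure (J j) = l%:E) ->
  (forall i j x, J i x -> J j x -> i = j) ->
  (forall j x, j \in T -> J j x -> d <= `|F x| /\ r <= rho x) ->
  ((d `^ p * r * l *+ #|T|)%:E <= wint rho p (fun x => real_complex R (F x)))%E.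
Proof.
move=> p0 d0 r0 mF mJ lJ Jinj JF.
have dr0 : 0 <= d `^ p * r by rewrite mulr_ge0// powR_ge0.
pose u (j : 'I_m) := (cst (d `^ p * r)%:E : R -> \bar R) \_ (J j).
have u0 j x : (0 <= u j x)%E.
  by rewrite /u patchE; case: ifPn => // _; rewrite lee_fin.
have mu_ j : measurable_fun [set: R] (u j).
  by apply/(measurable_restrictT _ _).1 => //; exact: measurable_cst.
apply: (@le_trans _ _ (\int[lebesgue_measure]_x (\sum_(j <- enum T) u j x))%E).
  rewrite ge0_integral_sum//.
  rewrite (eq_bigr (fun=> (d `^ p * r * l)%:E)).
    by rewrite sumEFin big_enum/= sumr_const.
  move=> j _; rewrite -integral_mkcond integral_cst; last exact: mJ.
  by rewrite [RHS]EFinM; congr (_ * _)%E; exact: lJ.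
rewrite /wint; apply: ge0_le_integral => //.
- by move=> x _; apply: sume_ge0 => j _.
- by apply: emeasurable_sum.
- by apply/measurable_EFinP; exact: measurable_wint (cmeasurable_real mF).
move=> x _; rewrite normc_real big_enum/=.
have [[j [jT jx]]|/forallNP h] := pselect (exists j, j \in T /\ J j x).
  rewrite (bigD1 j)//= big1 ?adde0; last first.
    move=> i /andP[_ ij]; rewrite /u patchE memNset// => /Jinj/(_ jx) e.
    by rewrite e eqxx in ij.
  rewrite /u patchE mem_set// lee_fin.
  have [dF rr] := JF _ _ jT jx.
  by rewrite ler_pM ?powR_ge0// ge0_ler_powR ?nnegrE.
rewrite big1; first by rewrite lee_fin mulr_ge0 ?powR_ge0// ltW.
move=> j jT; rewrite /u patchE memNset// => jx.
by apply: (h j).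
Qed.

End weighted_integrals.

(** * Norms of splines *)

Section spline_norms.
Variables (R : realType) (rho : R -> R) (alpha : nat).
Hypothesis mrho : measurable_fun [set: R] rho.
Hypothesis rho_gt0 : forall x, 0 < rho x.

(** The representative of the weak derivative that enters the norm is unknown,
    but it agrees almost everywhere with the piecewise derivative. *)
Lemma wint_weak_deriv_spline q B r m k (c : 'rV[R]_m) :
  0 < q -> 0 <= B -> (k <= alpha)%N ->
  (forall x, `|dspline alpha k c x| <= B) ->
  (forall x, `[0, 1]%classic x -> rho x <= r) ->
  (wint rho q (weak_deriv k (fun x => real_complex R (spline alpha c x))) <=
   (B `^ q * r)%:E)%E.
Proof.
move=> q0 B0 ka dB rr.
have dc := is_weak_deriv_spline c ka.
have wd : is_weak_deriv k (fun x => real_complex R (spline alpha c x))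
    (weak_deriv k (fun x => real_complex R (spline alpha c x))).
  apply: (@xgetPex _ (fun=> 0) [set g | is_weak_deriv k _ g]).
  by eexists; exact: dc.
rewrite (wint_aeq mrho q _ _ (weak_deriv_unique wd dc)).
- apply: wint_le => //; first exact: measurable_dspline.
  exact: dspline_eq0.
- by case: wd => _ [[? _ _] [? _ _]] _.
- by apply: cmeasurable_real; exact: measurable_dspline.
Qed.

Lemma sobolev_norm_spline q B r m (c : 'rV[R]_m) :
  0 < q -> 0 <= B ->
  (forall k x, (k <= alpha)%N -> `|dspline alpha k c x| <= B) ->
  (forall x, `[0, 1]%classic x -> rho x <= r) ->
  (sobolev_norm rho alpha q (fun x => real_complex R (spline alpha c x)) <=
   ((r *+ alpha.+1) `^ q^-1 * B)%:E)%E.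
Proof.
move=> q0 B0 dB rr.
have r0 : 0 <= r.
  by apply: le_trans (ltW (rho_gt0 0)) (rr _ _); rewrite /= in_itv/= lexx ler01.
have w0 f : (0 <= wint rho q f)%E.
  by apply: integral_ge0 => x _; rewrite lee_fin mulr_ge0 ?powR_ge0// ltW.
have -> : (r *+ alpha.+1) `^ q^-1 * B = (B `^ q * r *+ alpha.+1) `^ q^-1.
  rewrite -mulrnAr powRM ?powR_ge0 ?mulrn_wge0// -powRrM divff ?gt_eqF//.
  by rewrite powRr1// mulrC.
rewrite -poweR_EFin /sobolev_norm.
apply: gt0_ler_poweR; rewrite ?invr_ge0 ?(ltW q0)//.
- by rewrite in_itv/= leey andbT sume_ge0.
- by rewrite in_itv/= leey andbT lee_fin mulrn_wge0// mulr_ge0// powR_ge0.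
rewrite big_mkord (@le_trans _ _ (\sum_(k < alpha.+1) (B `^ q * r)%:E)%E)//.
  apply: lee_sum => k _; apply: wint_weak_deriv_spline => //.
    by rewrite -ltnS.
  by move=> x; apply: dB; rewrite -ltnS.
by rewrite sumEFin sumr_const card_ord.
Qed.

Lemma spline_sobolev_space q r m (c : 'rV[R]_m) : 0 < q -> (0 < m)%N ->
  (forall x, `[0, 1]%classic x -> rho x <= r) ->
  sobolev_space rho alpha q (fun x => real_complex R (spline alpha c x)).
Proof.
move=> q0 m0 rr; split => [k ka|].
  by eexists; exact: is_weak_deriv_spline.
have [M M0 HM] := dspline_bound R alpha.
pose D := \sum_j `|c 0 j|.
have D0 : 0 <= D by exact: sumr_ge0.
have cD j : `|c 0 j| <= D by rewrite /D (bigD1 j)//= lerDl sumr_ge0.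
apply: le_lt_trans (ltry _).
apply: (@sobolev_norm_spline q (D * (M * m%:R ^+ alpha)) r) => //.
  by rewrite mulr_ge0// mulr_ge0 ?exprn_ge0// ltW.
by move=> k x ka; exact: HM.
Qed.

End spline_norms.

(** At least [n] of the [3 n] cells contribute, each on a set of measure
    [1 / (6 n)]; this is where the [1 / 6] comes from. *)
Lemma wint_spline_ge (R : realType) (rho : R -> R) alpha n (p r : R)
    (c : 'rV[R]_(3 * n)) :
  measurable_fun [set: R] rho -> (forall x, 0 < rho x) ->
  (0 < n)%N -> 0 <= p -> 0 <= r ->
  (forall x, `[0, 1]%classic x -> r <= rho x) ->
  (n <= #|unimod c|)%N ->
  ((((16^-1) ^+ alpha) `^ p * r / 6)%:E <=
   wint rho p (fun x => real_complex R (spline alpha c x)))%E.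
Proof.
move=> mrho rho0 n0 p0 r0 rr nc.
have m0 : (0 < 3 * n)%N by rewrite muln_gt0.
have d0 : 0 <= (16^-1 : R) ^+ alpha by rewrite exprn_ge0.
have h := @wint_ge R rho mrho rho0 p ((16^-1) ^+ alpha) r (2 * (3 * n)%:R)^-1
  (spline alpha c) (3 * n) (@middle_half R (3 * n)) (unimod c) p0 d0 r0.
apply: le_trans (h _ _ _ _ _).
- rewrite lee_fin -[leRHS]mulr_natr -[leRHS]mulrA.
  rewrite ler_wpM2l ?mulr_ge0 ?powR_ge0//.
  rewrite natrM ler_pdivlMl; last by rewrite !mulr_gt0// ltr0n.
  rewrite [leLHS](_ : _ = n%:R); first by rewrite ler_nat.
  by field.
- exact: (@measurable_dspline R alpha _ 0 c).
- by move=> j; exact: measurable_itv.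
- by move=> j; exact: middle_half_measure.
- move=> i j x /middle_half_cell ix /middle_half_cell jx.
  exact: cell_inj ix jx.
- move=> j x; rewrite inE => /eqP cj jx.
  split; first exact: spline_middle_half jx.
  exact/rr/(cell01 (middle_half_cell jx)).
Qed.

(** * Operators of finite rank *)

Lemma aeq_trans (R : realType) (f g h : R -> R[i]) :
  aeq f g -> aeq g h -> aeq f h.
Proof. exact: ae_eq_trans. Qed.

(** Linearity of the operator holds up to null sets only, so the expansion along
    the canonical basis is proved by induction on the number of terms. *)
Lemma operator_sum (R : realType) (V W : set (R -> R[i])) A m
    (L : 'rV[R]_m -> R -> R[i]) :
  linear_operator V W A -> (forall c, V (L c)) ->
  (forall a c c',
    L (a *: c + c') = fun x => real_complex R a * L c x + L c' x) ->
  forall c, aeq (A (L c))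
    (fun x => \sum_j real_complex R (c 0 j) * A (L (delta_mx 0 j)) x).
Proof.
move=> [_ _ Alin] VL Llin c.
rewrite [in X in aeq X _](row_sum_delta c).
elim: (index_enum _) => [|j s ih].
  (* [A 0 = 0], because [0 = -1 * 0 + 0]. *)
  rewrite big_nil; have := Alin (-1) _ _ (VL 0) (VL 0).
  have := Llin (-1) 0 0; rewrite scaler0 addr0 rmorphN1 => <- h.
  apply: (@filterS _ _ (ae_filter_ringOfSetsType lebesgue_measure) _ _ _ h).
  by move=> x /(_ Logic.I) ->; rewrite big_nil mulN1r addNr.
rewrite big_cons Llin.
have h := Alin (real_complex R (c 0 j)) _ _ (VL (delta_mx 0 j))
  (VL (\sum_(j <- s) c 0 j *: delta_mx 0 j)).
apply: (@filterS2 _ _ (ae_filter_ringOfSetsType lebesgue_measure) _ _ _ _ h ih).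
by move=> x /(_ Logic.I) -> /(_ Logic.I) e _; rewrite big_cons e.
Qed.

Lemma sum_real_complex (R : realType) (I : finType) (a : I -> R)
    (z : I -> R[i]) :
  \sum_i real_complex R (a i) * z i =
  Complex (\sum_i a i * complex.Re (z i)) (\sum_i a i * complex.Im (z i)).
Proof.
elim: (index_enum I) => [|i s ih]; first by rewrite !big_nil.
rewrite !big_cons ih; case: (z i) => u v.
apply/eqP; rewrite /real_complex_def eq_complex /=.
by rewrite !mul0r subr0 addr0 !eqxx.
Qed.

(** Row [j] of the matrix lists the real and imaginary parts of the coefficients
    of [A (L e_j)] along the [n] elements that span the range of [A]. *)
Lemma operator_kernel (R : realType) (V W : set (R -> R[i])) A m n
    (L : 'rV[R]_m -> R -> R[i]) :
  linear_operator V W A -> rank_le V A n -> (forall c, V (L c)) ->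
  (forall a c c',
    L (a *: c + c') = fun x => real_complex R a * L c x + L c' x) ->
  exists M : 'M[R]_(m, n + n), forall c, c *m M = 0 -> aeq (A (L c)) (fun=> 0).
Proof.
move=> Alin [g [Vg Ag]] VL Llin.
have /choice[C HC] : forall j : 'I_m, exists c : 'I_n -> R[i],
    aeq (A (L (delta_mx 0 j))) (fun x => \sum_(i < n) c i * A (g i) x).
  by move=> j; exact: Ag.
exists (row_mx (\matrix_(j, i) complex.Re (C j i))
               (\matrix_(j, i) complex.Im (C j i))) => c.
rewrite mul_mx_row => /eqP; rewrite row_mx_eq0 => /andP[/eqP cR /eqP cI].
apply: aeq_trans (operator_sum Alin VL Llin c) _.
have : \forall x \ae lebesgue_measure, forall j, [set: R] x ->
    A (L (delta_mx 0 j)) x = \sum_(i < n) C j i * A (g i) x.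
  exact: (@filter_forall _ _ _ _
    (ae_filter_ringOfSetsType lebesgue_measure) HC).
apply: (@filterS _ _ (ae_filter_ringOfSetsType lebesgue_measure)).
move=> x h xT.
under eq_bigr do rewrite (h _ xT) mulr_sumr.
rewrite exchange_big/= big1// => i _.
under eq_bigr do rewrite mulrA.
rewrite -mulr_suml sum_real_complex.
move/matrixP/(_ 0 i) : cR; rewrite !mxE; under eq_bigr do rewrite mxE.
move=> ->.
move/matrixP/(_ 0 i) : cI; rewrite !mxE; under eq_bigr do rewrite mxE.
move=> ->.
by rewrite mul0r.
Qed.

(** * The lower bound *)

Lemma lee_div_bound (R : realType) (a b : R) (x y : \bar R) :
  0 <= a -> 0 < b -> (a%:E <= x)%E -> (0 <= y)%E -> (y <= b%:E)%E ->
  ((a / b)%:E <= x / y)%E.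
Proof.
move=> a0 b0 ax y0 yb; rewrite EFinM; apply: lee_pmul => //.
  by rewrite lee_fin invr_ge0 ltW.
have -> : (b^-1)%:E = (b%:E)^-1%E by rewrite inver gt_eqF.
by rewrite lee_pV2// inE lee_fin ltW.
Qed.

Unset Implicit Arguments.
Set Strict Implicit.

Theorem proposition5p4 (R : realType) (rho : R -> R) (p q : R) (alpha : nat) :
  schwartz_mon rho -> 1 <= p -> p < q -> (1 <= alpha)%N ->
  exists C : R, 0 < C /\
    forall (n : nat) (A : (R -> R[i]) -> (R -> R[i])),
      (1 <= n)%N ->
      linear_operator (sobolev_space rho alpha q) (Lp_space rho p) A ->
      rank_le (sobolev_space rho alpha q) A n ->
      ((C * (1 / n%:R ^+ alpha))%:E <= opnorm_IsubA rho alpha q p A)%E.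
Proof.
move=> [[srho _] rho0 _] p1 pq _.
have p0 : 0 < p by exact: lt_le_trans ltr01 p1.
have q0 : 0 < q by exact: lt_trans pq.
have crho := smooth_continuous srho.
have mrho := continuous_measurable_fun crho.
have [y _ ry] := @EVT_min R rho 0 1 ler01 (continuous_subspaceT crho).
have [z _ rz] := @EVT_max R rho 0 1 ler01 (continuous_subspaceT crho).
have [M M0 HM] := dspline_bound R alpha.
pose d : R := (16^-1) ^+ alpha.
have d0 : 0 < d by rewrite exprn_gt0.
(* [w] bounds the weighted integral of [|f_c|^p] from below, and [b * n^alpha]
   the Sobolev norm of [f_c] from above. *)
move Ew : (d `^ p * rho y / 6) => w.
have w0 : 0 < w by rewrite -Ew divr_gt0// mulr_gt0// powR_gt0.
move Eb : ((rho z *+ alpha.+1) `^ q^-1 * (M * 3 ^+ alpha)) => b.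
have b0 : 0 < b.
  by rewrite -Eb mulr_gt0 ?powR_gt0 ?pmulrn_lgt0// mulr_gt0// exprn_gt0.
exists (w `^ p^-1 / b); split; first by rewrite divr_gt0// powR_gt0.
move=> n A n0 Alin Arank.
have m0 : (0 < 3 * n)%N by rewrite muln_gt0.
pose L (c : 'rV[R]_(3 * n)) x := real_complex R (spline alpha c x).
have VL c : sobolev_space rho alpha q (L c) by exact: spline_sobolev_space rz.
have Llin a c c' : L (a *: c + c') = fun x => real_complex R a * L c x + L c' x.
  by apply/funext => x; rewrite /L spline_linear rmorphD rmorphM.
have [Mx HMx] := operator_kernel Alin Arank VL Llin.
have [c [/HMx Ac0 c1]] := kernel_unimodular Mx.
rewrite (_ : (3 * n - (n + n))%N = n); last first.
  by rewrite addnn -mul2n -mulnBl mul1n.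
move=> nc.
have wL : (w%:E <= wint rho p (L c))%E.
  by rewrite -Ew; apply: wint_spline_ge => //; exact: ltW.
have mL : cmeasurable (L c).
  by apply: cmeasurable_real; exact: (@measurable_dspline R alpha _ 0 c).
have [[mAr mAi] _] := let: And3 h _ _ := Alin in h _ (VL c).
have LA : wint rho p (fun x => L c x - A (L c) x) = wint rho p (L c).
  apply: wint_aeq => //.
    have e (u v : R[i]) : complex.Re (u - v) = complex.Re u - complex.Re v /\
                          complex.Im (u - v) = complex.Im u - complex.Im v.
      by case: u v => ? ? [? ?].
    case: mL => mr mi; split.
      under eq_fun do rewrite (e _ _).1; exact: measurable_funB.
    under eq_fun do rewrite (e _ _).2; exact: measurable_funB.
  apply: (@filterS _ _ (ae_filter_ringOfSetsType lebesgue_measure) _ _ _ Ac0).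
  by move=> x h /h ->; rewrite subr0.
apply: (@le_trans _ _ (Lp_norm rho p (fun x => (L c x - A (L c) x)%R) /
    sobolev_norm rho alpha q (L c))%E); last first.
  apply: ereal_sup_ubound; exists (L c); last reflexivity.
  split; first exact: VL.
  (* [f_c] is not a null function, its weighted integral being at least [w]. *)
  move=> L0; move: wL; rewrite (wint_aeq mrho p mL _ L0); last first.
    by split; exact: measurable_cst.
  rewrite /wint; under eq_integral => x _.
    rewrite Normc.normc0 powR0; last by rewrite gt_eqF.
    rewrite mul0r; over.
  by rewrite integral0 lee_fin leNgt w0.
have -> : w `^ p^-1 / b * (1 / n%:R ^+ alpha) =
    w `^ p^-1 / (b * n%:R ^+ alpha).
  by rewrite mul1r invfM mulrA.
have na0 : 0 < n%:R ^+ alpha :> R by apply: exprn_gt0; rewrite ltr0n.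
apply: lee_div_bound.
- exact: powR_ge0.
- exact: mulr_gt0 b0 na0.
- rewrite /Lp_norm LA -poweR_EFin.
  have w_ge0 : (0 <= w%:E)%E by rewrite lee_fin; exact: ltW.
  apply: gt0_ler_poweR; [| | |exact: wL].
  + by rewrite invr_ge0; exact: ltW.
  + by rewrite in_itv/= leey andbT.
  + by rewrite in_itv/= leey andbT; exact: le_trans wL.
- exact: poweR_ge0.
rewrite -Eb -mulrA -(mulrA M) -exprMn -natrM.
apply: sobolev_norm_spline; [exact: mrho|exact: rho0|exact: q0| | |exact: rz].
  by apply: mulr_ge0; [exact: ltW|exact: exprn_ge0].
move=> k x ka; rewrite -[leRHS]mul1r.
by apply: HM; [exact: ka|exact: m0|exact: ler01|exact: c1].
Qed.
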